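(* Let $\mathcal{T}$ be a small category with a zero object and finite coproducts (denoted $*$) such that, for every object $a$ of $\mathcal{T}$, the sum (codiagonal) morphism $a*a\to a$ belongs to $\mathbf{E}_c(\mathcal{T})$. Let $\Bbbk$ be a commutative ring, $T$ a functor from $\mathcal{T}$ to $\Bbbk$-modules, $d\in\mathbb{N}$ and $(E,e)$ a pointed set of cardinality $d+2$. Suppose that the natural transformation $cr_{(E,e)}(T):t_E(T)\to T$ is an epimorphism possessing a weakly natural splitting. Then $\mathrm{Tor}^{\mathcal{T}}_*(F,T)=0$ for every functor $F:\mathcal{T}^{op}\to\Bbbk\text{-}\mathrm{Mod}$ which is polynomial of degree at most $d$.
   Context: $\mathbf{E}_c(\mathcal{T})$ is the subcategory of $\mathcal{T}$ with the same objects, in which a morphism $v:H\to G$ of $\mathcal{T}$ lies if and only if there exist an object $S$ of $\mathcal{T}$ and an isomorphism $H\simeq G*S$ through which $v$ is the canonical projection $G*S\to G$ (identity on $G$, zero on $S$). For a finite set $E$, $t_E$ is the endofunctor of the category of functors $\mathcal{T}\to\Bbbk\text{-}\mathrm{Mod}$ given by precomposition with $a\mapsto a^{*E}$ (the coproduct of copies of $a$ indexed by $E$). For $I\subset E$, $u^I_E:t_E\to\mathrm{Id}$ is the natural transformation given by precomposition with the natural morphism $a^{*E}\to a$ whose component $a\to a$ on the factor labelled by $x\in E$ is the identity if $x\in I$ and $0$ otherwise. For a finite pointed set $(E,e)$, $$cr_{(E,e)}:=\sum_{e\in I\subset E}(-1)^{\mathrm{Card}(I)-1}u^I_E:\ t_E\to\mathrm{Id}.$$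 If $F,G$ are functors defined on $\mathcal{T}$, a collection of morphisms $F(a)\to G(a)$, $a\in\mathrm{Ob}\,\mathcal{T}$, is weakly natural if it is natural with respect to the morphisms of $\mathbf{E}_c(\mathcal{T})$. A weakly natural splitting of $cr_{(E,e)}(T)$ is a weakly natural collection of linear maps $T(a)\to t_E(T)(a)=T(a^{*E})$ which are sections of $cr_{(E,e)}(T)(a)$. A functor $F:\mathcal{T}^{op}\to\Bbbk\text{-}\mathrm{Mod}$ is polynomial of degree at most $d$ if for all objects $a_1,\dots,a_{d+1}$ the kernel of $F(a_1*\dots*a_{d+1})\to\bigoplus_iF(a_1*\dots*\widehat{a_i}*\dots*a_{d+1})$ (induced by the inclusions omitting one factor) is zero. $\mathrm{Tor}^\mathcal{T}_*(F,T)$ denotes the left derived functors of the coend $F\otimes_\mathcal{T}T$. *)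

(* Defs.v *)
From HB Require Import structures.
From mathcomp Require Import all_boot all_algebra.
From mathcomp Require Import boolp classical_sets functions cardinality fsbigop.

Set Implicit Arguments.
Unset Strict Implicit.
Unset Printing Implicit Defensive.

Import GRing.Theory.
Local Open Scope ring_scope.
Local Open Scope quotient_scope.

Definition linear_pack (k : pzRingType) (U V : lmodType k) (f : U -> V)
    (fL : linear f) : {linear U -> V} :=
  HB.pack f (GRing.isLinear.Build k U V *:%R f fL).

Section Submodule.
Variables (k : pzRingType) (V : lmodType k) (S : submodClosed V).

Record submodT : Type := SubmodT { submod_val : V; _ : submod_val \in S }.
HB.instance Definition _ := [isSub for submod_val].
HB.instance Definition _ := [Choice of submodT by <:].
HB.instance Definition _ := [SubChoice_isSubLmodule of submodT by <:].

Definition submod_incl : {linear submodT -> V} := val.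

(* Quotient.quot only carries a Z-module structure; the scaling is added here. *)
Fact submod_zmod_closed : zmod_closed S.
Proof. exact: GRing.subsemimod_closedB (GRing.subsemimodClosedP S). Qed.

Definition submod_zmodClosed : zmodClosed V :=
  HB.pack (S : {pred V})
    (GRing.isZmodClosed.Build V (S : {pred V}) submod_zmod_closed).

Definition lquot : Type := ring_quotient.Quotient.quot submod_zmodClosed.
HB.instance Definition _ := GRing.Zmodule.on lquot.

Definition lquot_class (v : V) : lquot :=
  \pi_(ring_quotient.Quotient.quot submod_zmodClosed) v.
Definition lrepr (q : lquot) : V :=
  repr (q : ring_quotient.Quotient.quot submod_zmodClosed).

Let toqK : cancel lrepr lquot_class. Proof. exact: reprK. Qed.

Let toq_eq u v : (lquot_class u == lquot_class v) = (u - v \in S).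
Proof. by rewrite (ring_quotient.Quotient.idealrBE submod_zmodClosed). Qed.

Let toqB : zmod_morphism lquot_class.
Proof. by move=> u v; rewrite /lquot_class; exact: raddfB. Qed.

Let toqD u v : lquot_class (u + v) = lquot_class u + lquot_class v.
Proof.
have toqN w : lquot_class (- w) = - lquot_class w.
  by rewrite -sub0r toqB -[X in lquot_class X](subrr 0) toqB subrr sub0r.
by rewrite -[v in LHS]opprK toqB toqN opprK.
Qed.

Definition lquot_scale (a : k) (q : lquot) : lquot := lquot_class (a *: lrepr q).

Let scale_toq a v : lquot_scale a (lquot_class v) = lquot_class (a *: v).
Proof. by apply/eqP; rewrite toq_eq -scalerBr rpredZ // -toq_eq toqK. Qed.

Fact lquot_scaleA a b q :
  lquot_scale a (lquot_scale b q) = lquot_scale (a * b) q.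
Proof. by rewrite -[q]toqK !scale_toq scalerA. Qed.
Fact lquot_scale1 : left_id 1 lquot_scale.
Proof. by move=> q; rewrite -[q]toqK scale_toq scale1r. Qed.
Fact lquot_scaleDr : right_distributive lquot_scale +%R.
Proof.
by move=> a p q; rewrite -[p]toqK -[q]toqK -toqD !scale_toq scalerDr toqD.
Qed.
Fact lquot_scaleDl q : {morph lquot_scale^~ q : a b / a + b}.
Proof. by move=> a b; rewrite -[q]toqK !scale_toq scalerDl toqD. Qed.

HB.instance Definition _ := GRing.Zmodule_isLmodule.Build k lquot
  lquot_scaleA lquot_scale1 lquot_scaleDr lquot_scaleDl.

Fact lpi_linear : linear (lquot_class : V -> lquot).
Proof. by move=> a u v; rewrite toqD -scale_toq. Qed.

Definition lpi : {linear V -> lquot} := linear_pack lpi_linear.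

Lemma lreprK : cancel lrepr lpi. Proof. exact: toqK. Qed.

Lemma lpi_eq0 v : (lpi v == 0) = (v \in S).
Proof. by rewrite -[0](linear0 lpi) [LHS]toq_eq subr0. Qed.

Section Lift.
Variables (W : lmodType k) (f : {linear V -> W}).
Hypothesis fS : forall v, v \in S -> f v = 0.

Fact lquot_lift_linear : linear (fun q : lquot => f (lrepr q)).
Proof.
move=> a p q; rewrite -linearZ -linearD; apply/eqP.
rewrite -subr_eq0 -linearB; apply/eqP/fS.
by rewrite -lpi_eq0 linearB linearD linearZ !lreprK subrr.
Qed.
Definition lquot_lift : {linear lquot -> W} := linear_pack lquot_lift_linear.

Lemma lquot_liftE v : lquot_lift (lpi v) = f v.
Proof.
apply/eqP; rewrite -subr_eq0 [lquot_lift _]/(f _) -linearB; apply/eqP/fS.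
by rewrite -lpi_eq0 linearB lreprK subrr.
Qed.
End Lift.
End Submodule.

Arguments lpi {k V} S : simpl never.
Arguments lquot_lift {k V S W f} fS : simpl never.
Arguments submod_incl {k V} S.

Section Kernel.
Variables (k : pzRingType) (U V W : lmodType k).

Definition kermod (f : {linear U -> V}) : {pred U} := fun u => f u == 0.
Fact kermod_closed f : GRing.subsemimod_closed (kermod f).
Proof.
split=> [|a u]; last by rewrite !unfold_in linearZ /= => /eqP->; rewrite scaler0.
split=> [|u v]; rewrite !unfold_in ?linear0 // linearD.
by move=> /eqP-> /eqP->; rewrite addr0.
Qed.
HB.instance Definition _ f :=
  GRing.isSubmodClosed.Build k U (kermod f) (kermod_closed f).

(* The preimage under f of the image of g. *)
Definition preimmod (f : {linear U -> V}) (g : {linear W -> V}) : {pred U} :=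
  fun u => `[< exists w, g w = f u >].
Fact preimmod_closed f g : GRing.subsemimod_closed (preimmod f g).
Proof.
split=> [|a u]; last first.
  by move=> /asboolP[w gw]; apply/asboolP; exists (a *: w); rewrite !linearZ /= gw.
split=> [|u v]; first by apply/asboolP; exists 0; rewrite !linear0.
move=> /asboolP[w gw] /asboolP[w' gw']; apply/asboolP.
by exists (w + w'); rewrite !linearD gw gw'.
Qed.
HB.instance Definition _ f g :=
  GRing.isSubmodClosed.Build k U (preimmod f g) (preimmod_closed f g).
End Kernel.

Section Span.
Variables (k : pzRingType) (V : lmodType k) (A : V -> Prop).

Definition spanmod : {pred V} :=
  fun v => `[< forall S : submodClosed V, (forall u, A u -> u \in S) -> v \in S >].
Fact spanmod_closed : GRing.subsemimod_closed spanmod.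
Proof.
split=> [|a u /asboolP Su]; last first.
  by apply/asboolP => S AS; rewrite rpredZ ?Su.
split=> [|u v /asboolP Su /asboolP Sv]; apply/asboolP => S AS.
  exact: rpred0.
by rewrite rpredD ?Su ?Sv.
Qed.
HB.instance Definition _ :=
  GRing.isSubmodClosed.Build k V spanmod spanmod_closed.

Lemma spanmod_gen v : A v -> v \in spanmod.
Proof. by move=> Av; apply/asboolP => S; apply. Qed.
End Span.

Section FreeModule.
Variables (k : pzRingType) (X : Type).

Definition finsupp_fun : {pred (X -> k^o)} :=
  fun f => `[< finite_set [set x | f x != 0] >].
Fact finsupp_fun_closed : GRing.subsemimod_closed finsupp_fun.
Proof.
split=> [|a f /asboolP fF]; last first.
  apply/asboolP; apply: sub_finite_set fF => x /=.
  by apply: contra_neq => fx; rewrite [LHS](_ : _ = a *: f x) // fx scaler0.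
split=> [|f g /asboolP fF /asboolP gF]; apply/asboolP.
  rewrite (_ : mkset _ = classical_sets.set0) // -classical_sets.subset0 => x /=.
  by rewrite (_ : (0 : X -> k^o) x = 0) // eqxx.
apply: (@sub_finite_set _ _ ([set x | f x != 0] `|` [set x | g x != 0])%classic).
  move=> x /=; have [fx|] := eqVneq (f x) 0; last by left.
  have [gx|] := eqVneq (g x) 0; last by right.
  by rewrite (_ : (f + g) x = f x + g x) // fx gx addr0 eqxx.
by rewrite finite_setU.
Qed.
HB.instance Definition _ :=
  GRing.isSubmodClosed.Build k (X -> k^o) finsupp_fun finsupp_fun_closed.

Definition freemod : lmodType k := submodT finsupp_fun.
Definition fcoef (f : freemod) (x : X) : k := val f x.

Fact fdelta_subproof (x : X) :
  (fun y => (`[< y = x >])%:R : k^o) \in finsupp_fun.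
Proof.
apply/asboolP; apply: (@sub_finite_set _ _ [set x]%classic) => // y /=.
by case: asboolP => // _; rewrite eqxx.
Qed.
Definition fdelta (x : X) : freemod := SubmodT (fdelta_subproof x).

Lemma fcoef_supp (f : freemod) :
  exists s : seq {classic X}, forall x, fcoef f x != 0 -> x \in s.
Proof.
have /asboolP fF := valP f.
have [s sE] := (iffLR (@finite_seqP {classic X} _) fF).
by exists s => x fx; have : [set` s]%classic x by rewrite -sE.
Qed.

Section Lift.
Variables (V : lmodType k) (v : X -> V).

Definition free_lift_fun (f : freemod) : V :=
  \sum_(x \in [set: {classic X}]) fcoef f x *: v x.

Lemma free_lift_sum (s : seq {classic X}) (f : freemod) : uniq s ->
  (forall x, fcoef f x != 0 -> x \in s) ->
  free_lift_fun f = \sum_(x <- s) fcoef f x *: v x.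
Proof.
move=> us fs; rewrite [RHS]fsbig_seq //; apply/esym/fsbig_widen => //.
move=> x /= [_ xs]; rewrite /= (_ : fcoef f x = 0) ?scale0r //.
by apply/eqP/negPn/negP => /fs.
Qed.

Fact free_lift_linear : linear free_lift_fun.
Proof.
move=> a f g.
have [[s fs] [t gt]] := (fcoef_supp f, fcoef_supp g).
pose r := undup (s ++ t).
have cE x : fcoef (a *: f + g) x = a * fcoef f x + fcoef g x by [].
have fr x : fcoef f x != 0 -> (x : {classic X}) \in r.
  by move=> fx; rewrite mem_undup mem_cat (fs _ fx).
have gr x : fcoef g x != 0 -> (x : {classic X}) \in r.
  by move=> gx; rewrite mem_undup mem_cat (gt _ gx) orbT.
have fgr x : fcoef (a *: f + g) x != 0 -> (x : {classic X}) \in r.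
  rewrite cE; have [fx|/fr//] := eqVneq (fcoef f x) 0.
  have [gx|/gr//] := eqVneq (fcoef g x) 0.
  by rewrite fx gx mulr0 addr0 eqxx.
rewrite (free_lift_sum _ fr) ?(free_lift_sum _ gr) ?(free_lift_sum _ fgr);
  rewrite ?undup_uniq //.
rewrite scaler_sumr -big_split; apply: eq_bigr => x _.
by rewrite cE scalerDl scalerA.
Qed.
Definition free_lift : {linear freemod -> V} := linear_pack free_lift_linear.

Lemma free_liftE x : free_lift (fdelta x) = v x.
Proof.
rewrite [LHS](@free_lift_sum [:: x : {classic X}]) //.
  by rewrite big_seq1 /fcoef /=; case: asboolP => // _; rewrite scale1r.
move=> y; rewrite /fcoef /=; case: asboolP => [->|_]; last by rewrite eqxx.
by move=> _; exact: (@mem_head {classic X}).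
Qed.
End Lift.

Lemma free_ext (V : lmodType k) (f g : {linear freemod -> V}) :
  (forall x, f (fdelta x) = g (fdelta x)) -> f =1 g.
Proof.
move=> fg h.
have [s hs] := fcoef_supp h.
pose r := undup (s : seq {classic X}).
have -> : h = \sum_(x <- r) fcoef h x *: fdelta x.
  apply: val_inj; apply/funext => y.
  rewrite linear_sum fct_sumE.
  rewrite (eq_bigr (fun x => fcoef h x * (`[< y = x >])%:R)) //.
  have [ys|ys] := boolP ((y : {classic X}) \in r).
    rewrite (bigD1_seq (y : {classic X})) ?undup_uniq //= big1_seq.
      by case: asboolP => // _; rewrite addr0 mulr1.
    move=> x /andP[xy _]; case: asboolP => [yx|_]; last by rewrite mulr0.
    by rewrite yx eqxx in xy.
  transitivity (0 : k); last first.
    apply/esym/(@big1_seq _ _ _ {classic X}) => x /andP[_ xr].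
    by case: asboolP => [yx|_]; [rewrite yx xr in ys | rewrite mulr0].
  apply/eqP/negPn/negP => hy; move: ys; rewrite mem_undup => /negP; apply.
  exact: hs.
by rewrite !linear_sum; apply: eq_bigr => x _; rewrite !linearZ /= fg.
Qed.
End FreeModule.

Arguments free_lift {k X V} v : simpl never.

Record category := Category {
  ob :> Type;
  hom : ob -> ob -> Type;
  idm : forall a, hom a a;
  comp : forall a b c, hom b c -> hom a b -> hom a c;
  compA : forall a b c d (h : hom c d) (g : hom b c) (f : hom a b),
    comp h (comp g f) = comp (comp h g) f;
  comp1m : forall a b (f : hom a b), comp (idm b) f = f;
  compm1 : forall a b (f : hom a b), comp f (idm a) = f
}.
Arguments idm {_} a.
Arguments comp {_ _ _ _} _ _.

Definition op (C : category) : category :=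
  @Category C (fun a b => hom b a) (fun a => idm a)
    (fun a b c g f => comp f g)
    (fun a b c d h g f => esym (compA f g h))
    (fun a b f => compm1 f) (fun a b f => comp1m f).

Definition isomorphism (C : category) (a b : C) (f : hom a b) : Prop :=
  exists g : hom b a, comp g f = idm a /\ comp f g = idm b.

(* Coproducts are chosen for all families indexed by a finType; binary coproducts
   and the powers a^{*E} are the instances at bool and at constant families. *)
Record zcategory := ZCategory {
  zcat :> category;
  zob : zcat;
  from_zob : forall a, hom zob a;
  to_zob : forall a, hom a zob;
  from_zob_uniq : forall a (f : hom zob a), f = from_zob a;
  to_zob_uniq : forall a (f : hom a zob), f = to_zob a;
  coprod : forall I : finType, (I -> zcat) -> zcat;
  coinj : forall (I : finType) (a : I -> zcat) (i : I), hom (a i) (coprod a);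
  copair : forall (I : finType) (a : I -> zcat) (b : zcat),
    (forall i, hom (a i) b) -> hom (coprod a) b;
  copairE : forall (I : finType) (a : I -> zcat) (b : zcat)
    (f : forall i, hom (a i) b) i, comp (copair f) (coinj a i) = f i;
  copair_uniq : forall (I : finType) (a : I -> zcat) (b : zcat)
    (g h : hom (coprod a) b),
    (forall i, comp g (coinj a i) = comp h (coinj a i)) -> g = h
}.
Arguments zob {_}.
Arguments coinj {_ I} a i.
Arguments copair {_ I a b} f.

Section ZCategory.
Variable C : zcategory.

Definition zerom (a b : C) : hom a b := comp (from_zob b) (to_zob a).

Definition coprod2 (a b : C) : C := coprod (fun i : bool => if i then a else b).

Definition copair2 (a b c : C) (f : hom a c) (g : hom b c) :
    hom (coprod2 a b) c :=
  @copair C bool (fun i : bool => if i then a else b) c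
    (fun i => if i return hom (if i then a else b) c then f else g).

Definition codiag (a : C) : hom (coprod2 a a) a := copair2 (idm a) (idm a).

Definition coproj (a b : C) : hom (coprod2 a b) a :=
  copair2 (idm a) (zerom b a).

Definition Ec (a b : C) (v : hom a b) : Prop :=
  exists (s : C) (phi : hom a (coprod2 b s)),
    isomorphism phi /\ v = comp (coproj b s) phi.

Definition power (E : finType) (a : C) : C := coprod (fun _ : E => a).

Definition power_map (E : finType) (a b : C) (f : hom a b) :
    hom (power E a) (power E b) :=
  copair (fun x => comp (coinj (fun _ : E => b) x) f).

(* T(power_fold I a) is the component of u^I_E at a. *)
Definition power_fold (E : finType) (I : {set E}) (a : C) :
    hom (power E a) a :=
  copair (fun x : E => if x \in I then idm a else zerom a a).

Definition omit_incl (I : finType) (a : I -> C) (i : I) :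
    hom (coprod (fun j : {j : I | j != i} => a (val j))) (coprod a) :=
  copair (fun j : {j : I | j != i} => coinj a (val j)).

Lemma comp_zerom (a b c : C) (f : hom b c) : comp f (zerom a b) = zerom a c.
Proof. by rewrite /zerom compA [comp f _]from_zob_uniq. Qed.

Lemma zerom_comp (a b c : C) (f : hom a b) : comp (zerom b c) f = zerom a c.
Proof. by rewrite /zerom -compA [comp (to_zob _) f]to_zob_uniq. Qed.

Lemma power_map_id (E : finType) (a : C) : power_map E (idm a) = idm (power E a).
Proof.
by apply: copair_uniq => x; rewrite copairE compm1 comp1m.
Qed.

Lemma power_map_comp (E : finType) (a b c : C) (g : hom b c) (f : hom a b) :
  power_map E (comp g f) = comp (power_map E g) (power_map E f).
Proof.
apply: copair_uniq => x.
by rewrite copairE -compA copairE [in RHS]compA copairE compA.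
Qed.

Lemma power_fold_natural (E : finType) (I : {set E}) (a b : C) (f : hom a b) :
  comp (power_fold I b) (power_map E f) = comp f (power_fold I a).
Proof.
apply: copair_uniq => x.
rewrite -compA copairE [in LHS]compA copairE -[in RHS]compA copairE.
by case: ifP; rewrite ?comp1m ?compm1 // comp_zerom zerom_comp.
Qed.

End ZCategory.

Record modfunctor (k : comPzRingType) (C : category) := ModFunctor {
  fob :> C -> lmodType k;
  fmap : forall a b : C, hom a b -> {linear fob a -> fob b};
  fmap_id : forall (a : C) (x : fob a), fmap (idm a) x = x;
  fmap_comp : forall (a b c : C) (g : hom b c) (f : hom a b) (x : fob a),
    fmap (comp g f) x = fmap g (fmap f x)
}.
Arguments fmap {k C} _ {a b} _.

Record nattrans (k : comPzRingType) (C : category) (F G : modfunctor k C) :=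
  NatTrans {
  ncomp :> forall a : C, {linear F a -> G a};
  natural : forall (a b : C) (f : hom a b) (x : F a),
    ncomp b (fmap F f x) = fmap G f (ncomp a x)
}.

Section FunctorCategory.
Variables (k : comPzRingType) (C : category).
Implicit Types F G H P : modfunctor k C.

Definition epimorphism G H (eta : nattrans G H) : Prop :=
  forall (K : modfunctor k C) (f g : nattrans H K),
    (forall a x, f a (eta a x) = g a (eta a x)) -> forall a x, f a x = g a x.

Definition projective P : Prop :=
  forall (G H : modfunctor k C) (eta : nattrans G H) (f : nattrans P H),
    epimorphism eta ->
    exists g : nattrans P G, forall a x, eta a (g a x) = f a x.

(* Exactness in a category of functors is objectwise exactness. *)
Record projres F := ProjRes {
  res :> nat -> modfunctor k C;
  res_projective : forall n, projective (res n);
  res_d : forall n, nattrans (res n.+1) (res n);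
  res_aug : nattrans (res 0) F;
  res_aug_epi : epimorphism res_aug;
  res_exact0 : forall a (x : res 0 a),
    res_aug a x = 0 <-> exists y, res_d 0 a y = x;
  res_exactS : forall n a (x : res n.+1 a),
    res_d n a x = 0 <-> exists y, res_d n.+1 a y = x
}.

End FunctorCategory.

Section Coend.
Variables (k : comPzRingType) (C : category).
Implicit Types (F : modfunctor k (op C)) (T : modfunctor k C).

Definition coend_gen F T : Type := {a : C & (F a * T a)%type}.

Definition cgen F T (a : C) (y : F a) (x : T a) : freemod k (coend_gen F T) :=
  fdelta k (existT (fun a : C => (F a * T a)%type) a (y, x)).

Inductive coend_rel F T : freemod k (coend_gen F T) -> Prop :=
| CoendDl (a : C) (y y' : F a) (x : T a) :
    coend_rel (cgen (y + y') x - (cgen y x + cgen y' x))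
| CoendDr (a : C) (y : F a) (x x' : T a) :
    coend_rel (cgen y (x + x') - (cgen y x + cgen y x'))
| CoendZl (a : C) (r : k) (y : F a) (x : T a) :
    coend_rel (cgen (r *: y) x - r *: cgen y x)
| CoendZr (a : C) (r : k) (y : F a) (x : T a) :
    coend_rel (cgen y (r *: x) - r *: cgen y x)
| CoendNat (a b : C) (f : hom a b) (y : F b) (x : T a) :
    coend_rel (cgen (@fmap k (op C) F b a f y) x - cgen y (fmap T f x)).

(* The coend of F(a) (x)_k T(a), presented by generators and relations. *)
Definition coend F T : lmodType k := lquot (spanmod (@coend_rel F T)).

Definition tens F T (a : C) (y : F a) (x : T a) : coend F T :=
  lpi (spanmod (@coend_rel F T)) (cgen y x).

Section CoendTheory.
Variables (F : modfunctor k (op C)) (T : modfunctor k C).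

Let relE u v : coend_rel (u - v) ->
  lpi (spanmod (@coend_rel F T)) u = lpi (spanmod (@coend_rel F T)) v.
Proof.
move=> uv; apply/eqP; rewrite -subr_eq0 -linearB lpi_eq0.
exact: spanmod_gen.
Qed.

Lemma tensDl (a : C) (y y' : F a) (x : T a) :
  tens (y + y') x = tens y x + tens y' x.
Proof. by rewrite /tens (relE (CoendDl y y' x)) linearD. Qed.
Lemma tensDr (a : C) (y : F a) (x x' : T a) :
  tens y (x + x') = tens y x + tens y x'.
Proof. by rewrite /tens (relE (CoendDr y x x')) linearD. Qed.
Lemma tensZl (a : C) (r : k) (y : F a) (x : T a) :
  tens (r *: y) x = r *: tens y x.
Proof. by rewrite /tens (relE (CoendZl r y x)) linearZ. Qed.
Lemma tensZr (a : C) (r : k) (y : F a) (x : T a) :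
  tens y (r *: x) = r *: tens y x.
Proof. by rewrite /tens (relE (CoendZr r y x)) linearZ. Qed.
Lemma tensNat (a b : C) (f : hom a b) (y : F b) (x : T a) :
  tens (@fmap k (op C) F b a f y) x = tens y (fmap T f x).
Proof. exact: relE (CoendNat f y x). Qed.

Lemma coend_ext (W : lmodType k) (f g : {linear coend F T -> W}) :
  (forall (a : C) (y : F a) (x : T a), f (tens y x) = g (tens y x)) -> f =1 g.
Proof.
move=> fg q; rewrite -(lreprK q).
apply: (@free_ext _ _ _ (f \o lpi _) (g \o lpi _)) => -[a [y x]].
exact: fg.
Qed.

Section Lift.
Variables (W : lmodType k) (beta : forall a : C, F a -> T a -> W).
Hypothesis betaDl : forall a y y' x,
  @beta a (y + y') x = beta y x + beta y' x.
Hypothesis betaDr : forall a y x x',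
  @beta a y (x + x') = beta y x + beta y x'.
Hypothesis betaZl : forall a r y x, @beta a (r *: y) x = r *: beta y x.
Hypothesis betaZr : forall a r y x, @beta a y (r *: x) = r *: beta y x.
Hypothesis betaNat : forall (a b : C) (f : hom a b) (y : F b) (x : T a),
  beta (@fmap k (op C) F b a f y) x = beta y (fmap T f x).

Let lift0 : {linear freemod k (coend_gen F T) -> W} :=
  free_lift (fun u : coend_gen F T => beta (projT2 u).1 (projT2 u).2).

Let lift0E (a : C) (y : F a) (x : T a) : lift0 (cgen y x) = beta y x.
Proof. exact: free_liftE. Qed.

Fact coend_lift_subproof v : v \in spanmod (@coend_rel F T) -> lift0 v = 0.
Proof.
move=> /asboolP/(_ (kermod lift0)) vS; apply/eqP/vS => u [] *; apply/eqP;
  rewrite linearB ?(linearD lift0) ?(linearZZ lift0) !lift0E.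
- by rewrite betaDl subrr.
- by rewrite betaDr subrr.
- by rewrite betaZl subrr.
- by rewrite betaZr subrr.
- by rewrite betaNat subrr.
Qed.

Definition coend_lift : {linear coend F T -> W} :=
  lquot_lift coend_lift_subproof.

Lemma coend_liftE (a : C) (y : F a) (x : T a) :
  coend_lift (tens y x) = beta y x.
Proof. by rewrite [LHS]lquot_liftE lift0E. Qed.
End Lift.
End CoendTheory.

Section Functoriality.
Variables (F G : modfunctor k (op C)) (eta : nattrans F G) (T : modfunctor k C).

Definition coend_map : {linear coend F T -> coend G T}.
Proof.
apply: (@coend_lift F T (coend G T) (fun a y x => tens (eta a y) x)).
- by move=> a y y' x; rewrite linearD tensDl.
- by move=> a y x x'; rewrite tensDr.
- by move=> a r y x; rewrite linearZ tensZl.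
- by move=> a r y x; rewrite tensZr.
- by move=> a b f y x; rewrite natural tensNat.
Defined.

Lemma coend_mapE (a : C) (y : F a) (x : T a) :
  coend_map (tens y x) = tens (eta a y) x.
Proof. exact: coend_liftE. Qed.
End Functoriality.
End Coend.

Section Homology.
Variables (k : comPzRingType) (X : nat -> lmodType k).
Variable d : forall n, {linear X n.+1 -> X n}.

Definition cycles (n : nat) : lmodType k :=
  match n with 0 => X 0 | m.+1 => submodT (kermod (d m)) end.

Definition cycles_incl (n : nat) : {linear cycles n -> X n} :=
  match n return {linear cycles n -> X n} with
  | 0 => idfun
  | m.+1 => submod_incl (kermod (d m))
  end.

Definition homology (n : nat) : lmodType k :=
  lquot (preimmod (cycles_incl n) (d n)).

Definition is_cycle (n : nat) : X n -> Prop :=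
  match n return X n -> Prop with 0 => fun=> True | m.+1 => fun x => d m x = 0 end.

Lemma homology_eq0P (n : nat) :
  (forall h : homology n, h = 0) <->
  (forall x : X n, is_cycle x -> exists y, d n y = x).
Proof.
have cyc (x : X n) : is_cycle x <-> exists z, cycles_incl n z = x.
  case: n x => [|n] x /=; first by split=> // _; exists x.
  split=> [dx|[z <-]]; last by apply/eqP; case: z.
  by exists (SubmodT (introT eqP dx : x \in kermod (d n))).
split=> [H x /cyc[z <-]|H h].
  have /eqP := H (lpi _ z); rewrite lpi_eq0 => /asboolP[y yz].
  by exists y.
rewrite -(lreprK h); apply/eqP; rewrite lpi_eq0; apply/asboolP.
by apply: H; apply/cyc; exists (lrepr h).
Qed.
End Homology.

Section Tor.
Variables (k : comPzRingType) (C : category).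

(* The n-th left derived functor of F |-> coend F T, computed on a projective
   resolution P of F; such a P always exists, see free_resolution. *)
Definition Tor (F : modfunctor k (op C)) (T : modfunctor k C) (P : projres F)
    (n : nat) : lmodType k :=
  homology (fun i => coend_map (res_d P i) T) n.
End Tor.

Section CrossEffects.
Variables (k : comPzRingType) (C : zcategory).

(* Polynomial of degree at most d. *)
Definition polynomial_of_degree (d : nat) (F : modfunctor k (op C)) : Prop :=
  forall (a : 'I_d.+1 -> C) (x : F (coprod a)),
    (forall i, @fmap k (op C) F _ _ (omit_incl a i) x = 0) -> x = 0.

Section Power.
Variables (E : finType) (T : modfunctor k C).

Definition tpow : modfunctor k C.
Proof.
apply: (@ModFunctor k C (fun a => T (power E a))
  (fun a b f => fmap T (power_map E f))).
- by move=> a x; rewrite power_map_id fmap_id.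
- by move=> a b c g f x; rewrite power_map_comp fmap_comp.
Defined.

Definition ufold (I : {set E}) : nattrans tpow T.
Proof.
apply: (@NatTrans k C tpow T (fun a => fmap T (power_fold I a))).
by move=> a b f x; rewrite -!fmap_comp power_fold_natural.
Defined.

(* #|I|.-1 is the true predecessor, since e \in I. *)
Definition cr_fun (e : E) (a : C) (x : tpow a) : T a :=
  \sum_(I : {set E} | e \in I) (-1) ^+ #|I|.-1 *: ufold I a x.

Fact cr_linear e a : linear (@cr_fun e a).
Proof.
move=> r x y; rewrite /cr_fun scaler_sumr -big_split; apply: eq_bigr => I _.
by rewrite linearP scalerDr !scalerA mulrC.
Qed.

Definition cr (e : E) : nattrans tpow T.
Proof.
apply: (@NatTrans k C tpow T (fun a => linear_pack (@cr_linear e a))).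
move=> a b f x; rewrite /= /cr_fun linear_sum; apply: eq_bigr => I _.
by rewrite linearZ natural.
Defined.

End Power.

Definition weakly_natural (F G : modfunctor k C)
    (s : forall a : C, {linear F a -> G a}) : Prop :=
  forall (a b : C) (v : hom a b), Ec v ->
    forall x : F a, s b (fmap F v x) = fmap G v (s a x).

Definition weakly_natural_splitting (F G : modfunctor k C) (eta : nattrans F G)
    (s : forall a : C, {linear G a -> F a}) : Prop :=
  weakly_natural s /\ forall (a : C) (x : G a), eta a (s a x) = x.

End CrossEffects.

Section Resolutions.
Variables (k : comPzRingType) (C : category).
Implicit Types F G H P : modfunctor k C.

Section Cokernel.
Variables (G H : modfunctor k C) (eta : nattrans G H).

Definition coker_sub (a : C) : submodClosed (H a) := preimmod idfun (eta a).

Fact coker_fmap_subproof (a b : C) (f : hom a b) (x : H a) :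
  x \in coker_sub a -> (lpi (coker_sub b) \o fmap H f) x = 0.
Proof.
move=> /asboolP[y /= yx]; apply/eqP; rewrite /= lpi_eq0; apply/asboolP.
by exists (fmap G f y); rewrite natural yx.
Qed.

Definition coker_fmap (a b : C) (f : hom a b) :
    {linear lquot (coker_sub a) -> lquot (coker_sub b)} :=
  lquot_lift (@coker_fmap_subproof a b f).

Fact coker_fmapE (a b : C) (f : hom a b) (x : H a) :
  coker_fmap f (lpi (coker_sub a) x) = lpi (coker_sub b) (fmap H f x).
Proof. exact: lquot_liftE. Qed.

Definition coker : modfunctor k C.
Proof.
apply: (@ModFunctor k C (fun a => lquot (coker_sub a)) coker_fmap).
- by move=> a x; rewrite -(lreprK x) coker_fmapE fmap_id.
- by move=> a b c g f x; rewrite -(lreprK x) (coker_fmapE f) !coker_fmapE fmap_comp.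
Defined.

Definition coker_pi : nattrans H coker.
Proof.
apply: (@NatTrans k C H coker (fun a => lpi (coker_sub a))).
by move=> a b f x; rewrite [RHS]coker_fmapE.
Defined.

Definition coker_zero : nattrans H coker.
Proof.
apply: (@NatTrans k C H coker (fun a => \0%R : {linear H a -> coker a})).
by move=> a b f x; rewrite [RHS]linear0.
Defined.

Lemma epimorphismP :
  epimorphism eta <-> forall (a : C) (y : H a), exists x, eta a x = y.
Proof.
split=> [epi a y|surj K f g fg a y]; last first.
  by have [x <-] := surj a y; apply: fg.
have /= /eqP : coker_pi a y = coker_zero a y.
  apply: epi => {a y} a x /=; apply/eqP; rewrite lpi_eq0; apply/asboolP.
  by exists x.
by rewrite lpi_eq0 => /asboolP[x xy]; exists x.
Qed.
End Cokernel.

Section Kernel.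
Variables (G H : modfunctor k C) (eta : nattrans G H).

Definition kerf_map_fun (a b : C) (f : hom a b)
    (x : submodT (kermod (eta a))) : submodT (kermod (eta b)).
Proof.
exists (fmap G f (val x)).
abstract by case: x => x /eqP/= ex; apply/eqP; rewrite natural ex linear0.
Defined.

Fact kerf_map_linear (a b : C) (f : hom a b) : linear (kerf_map_fun f).
Proof. by move=> r x y; apply: val_inj; rewrite /= !linearP /=. Qed.

Definition kerf : modfunctor k C.
Proof.
apply: (@ModFunctor k C (fun a => submodT (kermod (eta a)))
  (fun a b f => linear_pack (kerf_map_linear f))).
- by move=> a x; apply: val_inj; rewrite /= fmap_id.
- by move=> a b c g f x; apply: val_inj; rewrite /= fmap_comp.
Defined.

Definition kerf_incl : nattrans kerf G.
Proof.
by apply: (@NatTrans k C kerf G (fun a => submod_incl (kermod (eta a)))).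
Defined.
End Kernel.

Section Free.
Variable F : modfunctor k C.

Definition freef_gen (b : C) : Type := {a : C & (F a * hom a b)%type}.

Definition freef_elt (a b : C) (x : F a) (f : hom a b) :
    freemod k (freef_gen b) :=
  fdelta k (existT (fun a : C => (F a * hom a b)%type) a (x, f)).

Definition freef_fmap (b c : C) (g : hom b c) :
    {linear freemod k (freef_gen b) -> freemod k (freef_gen c)} :=
  free_lift (fun u : freef_gen b =>
    freef_elt (projT2 u).1 (comp g (projT2 u).2)).

Lemma freef_fmapE (a b c : C) (g : hom b c) (x : F a) (f : hom a b) :
  freef_fmap g (freef_elt x f) = freef_elt x (comp g f).
Proof. exact: free_liftE. Qed.

Lemma freef_ext (b : C) (W : lmodType k)
    (h h' : {linear freemod k (freef_gen b) -> W}) :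
  (forall (a : C) (x : F a) (f : hom a b),
     h (freef_elt x f) = h' (freef_elt x f)) -> h =1 h'.
Proof. by move=> hh'; apply: free_ext => -[a [x f]]; apply: hh'. Qed.

Definition freef : modfunctor k C.
Proof.
apply: (@ModFunctor k C (fun b => freemod k (freef_gen b)) freef_fmap).
- move=> b; apply: (@freef_ext _ _ (freef_fmap (idm b)) idfun) => a x f.
  by rewrite freef_fmapE comp1m.
- move=> b c d h g.
  apply: (@freef_ext _ _ (freef_fmap (comp h g)) (freef_fmap h \o freef_fmap g)).
  move=> a x f; rewrite [LHS]freef_fmapE.
  by rewrite [RHS](congr1 (freef_fmap h) (freef_fmapE g x f)) freef_fmapE compA.
Defined.

Section FreeLift.
Variables (G : modfunctor k C) (y : forall a, F a -> G a).

Definition freef_lift_fun (b : C) : {linear freef b -> G b} :=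
  free_lift (fun u : freef_gen b => fmap G (projT2 u).2 (y (projT2 u).1)).

Lemma freef_lift_funE (a b : C) (x : F a) (f : hom a b) :
  freef_lift_fun b (freef_elt x f) = fmap G f (y x).
Proof. exact: free_liftE. Qed.

Definition freef_lift : nattrans freef G.
Proof.
apply: (@NatTrans k C freef G freef_lift_fun).
move=> b c g.
apply: (@freef_ext _ _ (freef_lift_fun c \o freef_fmap g)
  (fmap G g \o freef_lift_fun b)) => a x f.
rewrite [LHS](congr1 (freef_lift_fun c) (freef_fmapE g x f)).
rewrite [RHS](congr1 (fmap G g) (freef_lift_funE x f)).
by rewrite freef_lift_funE fmap_comp.
Defined.
End FreeLift.

Lemma freef_projective : projective freef.
Proof.
move=> G H eta f /epimorphismP surj.
have {}surj a x := cid (surj a (f a (freef_elt x (idm a)))).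
pose y a x := projT1 (surj a x).
exists (freef_lift y) => b.
apply: (@freef_ext _ _ (eta b \o freef_lift_fun y b) (f b)) => a x g.
rewrite [LHS](congr1 (eta b) (freef_lift_funE y x g)) natural.
rewrite (projT2 (surj a x)) -natural; congr (f b _).
by rewrite [LHS]freef_fmapE compm1.
Qed.

Definition freef_cover : nattrans freef F := freef_lift (fun a x => x).

Lemma freef_cover_surj (a : C) (x : F a) : exists y, freef_cover a y = x.
Proof.
by exists (freef_elt x (idm a)); rewrite [LHS]freef_lift_funE fmap_id.
Qed.
End Free.

Definition nattrans_comp F G H (g : nattrans G H) (f : nattrans F G) :
  nattrans F H.
Proof.
apply: (@NatTrans k C F H (fun a => g a \o f a)).
by move=> a b h x; rewrite /= !natural.
Defined.

Fixpoint syzygy F (n : nat) : modfunctor k C :=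
  if n is m.+1 then kerf (freef_cover (syzygy F m)) else F.

Lemma kerf_cover_exact F G (g : nattrans F G) (a : C) (x : F a) :
  g a x = 0 <-> exists y,
    nattrans_comp (kerf_incl g) (freef_cover (kerf g)) a y = x.
Proof.
split=> [gx|[y <-]]; last exact: (eqP (valP (freef_cover (kerf g) a y))).
have [y yx] := freef_cover_surj
  (SubmodT (introT eqP gx : x \in kermod (g a)) : kerf g a).
by exists y; apply: (congr1 val yx).
Qed.

Definition free_res_d F (n : nat) :
    nattrans (freef (syzygy F n.+1)) (freef (syzygy F n)) :=
  nattrans_comp (kerf_incl (freef_cover (syzygy F n)))
    (freef_cover (kerf (freef_cover (syzygy F n)))).

Definition free_resolution F : projres F.
Proof.
apply: (@ProjRes k C F (fun n => freef (syzygy F n))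
  (fun n => @freef_projective _) (@free_res_d F) (freef_cover F)).
- by apply/epimorphismP => a x; apply: freef_cover_surj.
- by move=> a x; apply: kerf_cover_exact.
- move=> n a x; rewrite -(kerf_cover_exact (freef_cover (syzygy F n.+1))).
  split=> [e|e]; first by apply: val_inj.
  exact: (congr1 val e).
Defined.

End Resolutions.

(* Main.v *)
(* cr_(E,e) acts on both variables of F (x) T: y (x) cr z = m (cr^* y (x) z), where
   cr^* : F -> F(-^{*E}) is its contravariant analogue and
   m : F(-^{*E}) (x) t_E T -> F (x) T sends y (x) z to y (x) z.  If F is polynomial
   of degree at most d then cr^* vanishes on F, hence is null-homotopic on a
   projective resolution P of F; so cr sends cycles of P (x) t_E T to boundaries of
   P (x) T.

   Let K be the kernel of cr(T).  The splitting s of cr(T) restricts, after the swap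
   of the two factors of E x E, to a weakly natural splitting of cr(K): the swap turns
   cr at a^{*E} into t_E T applied to the folds a^{*E} -> a, which lie in E_c because
   the codiagonals do, so s commutes with them.  The vanishing then follows by
   induction on n, for all T at once: a cycle of P_n (x) T lifts to P_n (x) t_E T,
   its boundary comes from a cycle of P_{n-1} (x) K, which is a boundary by induction,
   so the lift can be corrected to a cycle. *)
From HB Require Import structures.
From mathcomp Require Import all_boot all_algebra.
From mathcomp Require Import boolp.
(* Defs comes last because all_algebra also exports a constant named hom. *)
Require Import Defs.

Set Implicit Arguments.
Unset Strict Implicit.
Unset Printing Implicit Defensive.

Import GRing.Theory.
Local Open Scope ring_scope.

(** * Morphisms of E_c *)

Section ProjectionsOntoSummands.
Variable C : zcategory.

Definition inl2 (a b : C) : hom a (coprod2 a b) :=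
  coinj (fun i : bool => if i then a else b) true.
Definition inr2 (a b : C) : hom b (coprod2 a b) :=
  coinj (fun i : bool => if i then a else b) false.

Lemma copair2_inl (a b c : C) (f : hom a c) (g : hom b c) :
  comp (copair2 f g) (inl2 a b) = f.
Proof. exact: (copairE _ true). Qed.

Lemma copair2_inr (a b c : C) (f : hom a c) (g : hom b c) :
  comp (copair2 f g) (inr2 a b) = g.
Proof. exact: (copairE _ false). Qed.

Lemma copair2_uniq (a b c : C) (g h : hom (coprod2 a b) c) :
  comp g (inl2 a b) = comp h (inl2 a b) ->
  comp g (inr2 a b) = comp h (inr2 a b) -> g = h.
Proof. by move=> gl gr; apply: copair_uniq => -[]. Qed.

(** Stated by universal property for arbitrary [z], [i], [j], because the decompositions used below
    are of objects other than the chosen [coprod2 b s]. *)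
Definition is_coproduct2 (b s z : C) (i : hom b z) (j : hom s z) : Prop :=
  (forall c (f : hom b c) (g : hom s c),
     exists h : hom z c, comp h i = f /\ comp h j = g) /\
  (forall c (h h' : hom z c),
     comp h i = comp h' i -> comp h j = comp h' j -> h = h').

(** Transports the chosen coproduct along the isomorphism, and conversely. Membership in E_c then
    amounts to giving two injections with a universal property, with no explicit inverse. *)
Lemma EcP (a b : C) (v : hom a b) :
  Ec v <-> exists s (i : hom b a) (j : hom s a),
    [/\ is_coproduct2 i j, comp v i = idm b & comp v j = zerom s b].
Proof.
split=> [[s [phi [[psi [psiK phiK]] ->]]]|[s [i [j [[ex uq] vi vj]]]]].
  exists s, (comp psi (inl2 b s)), (comp psi (inr2 b s)); split.
  - split=> [c f g|c h h' hl hr].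
      exists (comp (copair2 f g) phi).
      by rewrite -!compA ![comp phi (comp _ _)]compA phiK !comp1m copair2_inl
        copair2_inr.
    have : comp h psi = comp h' psi by apply: copair2_uniq; rewrite -!compA.
    by move/(congr1 (fun u => comp u phi)); rewrite -!compA psiK !compm1.
  - by rewrite -compA [comp phi _]compA phiK comp1m copair2_inl.
  - by rewrite -compA [comp phi _]compA phiK comp1m copair2_inr.
have [phi [phii phij]] := ex _ (inl2 b s) (inr2 b s).
exists s, phi; split.
  exists (copair2 i j); split.
    apply: uq; rewrite comp1m -compA ?phii ?phij;
    by rewrite ?copair2_inl ?copair2_inr.
  apply: copair2_uniq; rewrite comp1m -compA ?copair2_inl ?copair2_inr //.
by apply: uq; rewrite -compA ?phii ?phij ?copair2_inl ?copair2_inr.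
Qed.

(** Powers commute with binary coproducts, so a complement [s] of [b] yields the complement
    [power E s] of [power E b]. *)
Lemma Ec_power_map (E : finType) (a b : C) (v : hom a b) :
  Ec v -> Ec (power_map E v).
Proof.
move=> /EcP[s [i [j [[ex uq] vi vj]]]]; apply/EcP.
exists (power E s), (power_map E i), (power_map E j); split.
- split=> [c f g|c h h' hi hj].
    have /choice[h hP] (x : E) := ex _ (comp f (coinj _ x)) (comp g (coinj _ x)).
    exists (copair h); split; apply: copair_uniq => x;
    by rewrite -compA copairE compA copairE; case: (hP x).
  apply: copair_uniq => x; apply: uq; rewrite -!compA.
    have := congr1 (fun u => comp u (coinj (fun _ : E => b) x)) hi.
    by rewrite -!compA !copairE.
  have := congr1 (fun u => comp u (coinj (fun _ : E => s) x)) hj.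
  by rewrite -!compA !copairE.
- by rewrite -power_map_comp vi power_map_id.
rewrite -power_map_comp vj; apply: copair_uniq => x.
by rewrite copairE comp_zerom zerom_comp.
Qed.

(* z is the coproduct of r and of one copy of a for each element of js. *)
Definition is_coproduct_seq (a r z : C) (js : seq (hom a z)) (j : hom r z)
  : Prop :=
  (forall c (fs : seq (hom a c)) (g : hom r c), size fs = size js ->
     exists h : hom z c, map (comp h) js = fs /\ comp h j = g) /\
  (forall c (h h' : hom z c),
     map (comp h) js = map (comp h') js -> comp h j = comp h' j -> h = h').

Hypothesis codiag_Ec : forall a : C, Ec (codiag a).

(* Splitting a * a along the codiagonal trades two copies of a for a single one
   and a bigger complement. *)
Lemma Ec_fold_seq (a z : C) (v : hom z a) (n : nat) :
  forall (r : C) (js : seq (hom a z)) (j : hom r z),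
    size js = n.+1 -> is_coproduct_seq js j ->
    map (comp v) js = nseq n.+1 (idm a) -> comp v j = zerom r a -> Ec v.
Proof.
elim: n => [|n IHn] r [//|i js] j /= [szjs] [ex uq] [vi vjs] vj.
  move: szjs vjs ex uq => /size0nil-> _ ex uq; apply/EcP; exists r, i, j; split=> //.
  split=> [c f g|c h h' hi hj]; last by apply: uq; rewrite //= hi.
  by have [|h [[hi] hj]] := ex c [:: f] g; last by exists h.
case: js szjs vjs ex uq => [//|i' js] /= [szjs] [vi' vjs] ex uq.
have /EcP[t [u [w [[ex' uq'] cu cw]]]] := codiag_Ec a.
have vE : comp v (copair2 i i') = codiag a.
  by apply: copair2_uniq; rewrite -compA !(copair2_inl, copair2_inr).
(* Here [u] and [w] present a * a as a * t with the codiagonal as projection. The two copies [i],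
   [i'] become the single copy [u], and [t] joins the complement [r]. *)
apply: (IHn _ (comp (copair2 i i') u :: js)
  (copair2 (comp (copair2 i i') w) j)) => /=.
- by rewrite szjs.
- split=> /= [c [//|f fs] g [szfs]|c h h' [hu hjs] hj].
    have [q [qu qw]] := ex' c f (comp g (inl2 t r)).
    have [|h [[hi hi' hjs] hj]] :=
      ex c [:: comp q (inl2 a a), comp q (inr2 a a) & fs] (comp g (inr2 t r)).
      by rewrite /= szfs.
    have hq : comp h (copair2 i i') = q.
      by apply: copair2_uniq; rewrite -compA !(copair2_inl, copair2_inr).
    exists h; rewrite compA hq qu hjs; split=> //.
    apply: copair2_uniq; rewrite -compA !(copair2_inl, copair2_inr) //.
    by rewrite compA hq qw.
  have hw := congr1 (fun q => comp q (inl2 t r)) hj.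
  have hr := congr1 (fun q => comp q (inr2 t r)) hj.
  rewrite -!compA !(copair2_inl, copair2_inr) in hw hr.
  have hh : comp h (copair2 i i') = comp h' (copair2 i i').
    by apply: uq'; rewrite -!compA.
  have hi := congr1 (fun q => comp q (inl2 a a)) hh.
  have hi' := congr1 (fun q => comp q (inr2 a a)) hh.
  rewrite -!compA !(copair2_inl, copair2_inr) in hi hi'.
  by apply: uq => //; rewrite hi hi' hjs.
- by rewrite compA vE cu vjs.
apply: copair2_uniq; rewrite -compA !(copair2_inl, copair2_inr) ?zerom_comp //.
by rewrite compA vE cw.
Qed.

(** The factors labelled by [I] are the copies of [a] to be folded, and the power over the labels
    outside [I] is the complement. The point [e] provides the first copy. *)
Lemma Ec_power_fold (E : finType) (I : {set E}) (e : E) (a : C) :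
  e \in I -> Ec (power_fold I a).
Proof.
move=> eI; have cI : #|I| = #|I|.-1.+1 by rewrite prednK //; apply/card_gt0P; exists e.
pose K : finType := {x : E | x \notin I}.
apply: (@Ec_fold_seq _ _ _ #|I|.-1 (power K a)
  [seq coinj (fun _ : E => a) x | x <- enum I]
  (copair (fun x : K => coinj (fun _ : E => a) (val x)))).
- by rewrite size_map -cardE.
- split=> [c fs g szfs|c h h' hI hK].
    (* [insub x] succeeds exactly for [x] outside [I]; otherwise the index of [x] is within bounds,
       so the default of [nth] is never read. *)
    exists (copair (fun x : E => if insub x is Some u
      then comp g (coinj (fun _ : K => a) u)
      else nth (zerom a c) fs (index x (enum I)))); split.
      rewrite size_map in szfs.
      rewrite -map_comp; apply: (@eq_from_nth _ (zerom a c)); rewrite size_map // => m mI.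
      rewrite (nth_map e) //= copairE insubF ?index_uniq ?enum_uniq //.
      by apply/negbTE; rewrite negbK -mem_enum mem_nth.
    by apply: copair_uniq => x; rewrite -compA !copairE valK.
  apply: copair_uniq => x; have [xI|xI] := boolP (x \in I).
    move: hI; rewrite -!map_comp => /eq_in_map; apply; by rewrite mem_enum.
  have := congr1 (fun u => comp u (coinj (fun _ : K => a) (exist _ x xI))) hK.
  by rewrite -!compA !copairE.
- have nseqE s : nseq (size s) (idm a) = [seq idm a | x : E <- s].
    by elim: s => //= x s ->.
  rewrite -cI cardE nseqE -map_comp.
  apply/eq_in_map => x; rewrite mem_enum /= copairE => -> //.
by apply: copair_uniq => -[x xI]; rewrite -compA !copairE (negbTE xI) zerom_comp.
Qed.

End ProjectionsOntoSummands.

(** * Cross effects of contravariant functors *)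

(** Adjoining or removing [x] is a sign-reversing involution on the index sets, and [x != e] keeps
    [e] in them. *)
Lemma alternating_sum_eq0 (k : pzRingType) (V : lmodType k) (E : finType)
    (e x : E) (G : {set E} -> V) :
  x != e -> (forall I : {set E}, x \notin I -> G (x |: I) = G I) ->
  \sum_(I : {set E} | e \in I) (-1) ^+ #|I|.-1 *: G I = 0.
Proof.
move=> xe Gx; rewrite (bigID (fun I : {set E} => x \in I)) /=.
rewrite (reindex_onto (fun I : {set E} => x |: I) (fun I => I :\ x)) /=; last first.
  by move=> I /andP[_ xI]; rewrite setD1K.
rewrite (eq_bigl (fun I : {set E} => (e \in I) && (x \notin I))); last first.
  move=> I; rewrite !inE eqxx eq_sym (negbTE xe) /= andbT; congr (_ && _).
  apply/eqP/idP => [<-|xI]; first by rewrite !inE eqxx.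
  by apply/setP => y; rewrite !inE; case: eqVneq => //= ->; rewrite (negbTE xI).
rewrite -big_split big1 // => I /andP[eI xI] /=.
(* Since [I] is nonempty, its predecessor cardinal is the true one, and adjoining [x] does change
   the sign. *)
have /prednK cI : (0 < #|I|)%N by apply/card_gt0P; exists e.
by rewrite Gx // cardsU1 xI /= -[in X in X *: _ + _]cI exprS mulN1r scaleNr addNr.
Qed.

Section ContravariantPowers.
Variables (k : comPzRingType) (C : zcategory) (E : finType).
Implicit Types F G : modfunctor k (op C).

Definition tpow_op F : modfunctor k (op C).
Proof.
apply: (@ModFunctor k (op C) (fun a => F (power E a))
  (fun a b f => @fmap k (op C) F (power E a) (power E b) (power_map E f))).
- by move=> a x; rewrite /= power_map_id; apply: (@fmap_id k (op C) F).
- move=> a b c g f x; rewrite /= power_map_comp.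
  exact: (@fmap_comp k (op C) F).
Defined.

Definition tpow_op_map F G (h : nattrans F G) : nattrans (tpow_op F) (tpow_op G).
Proof.
apply: (@NatTrans k (op C) (tpow_op F) (tpow_op G) (fun a => h (power E a))).
by move=> a b f x; apply: (@natural k (op C) F G h).
Defined.

Variable e : E.

Definition cr_op_fun F (a : C) (x : F a) : tpow_op F a :=
  \sum_(I : {set E} | e \in I)
    (-1) ^+ #|I|.-1 *: @fmap k (op C) F a (power E a) (power_fold I a) x.

Fact cr_op_linear F (a : C) : linear (@cr_op_fun F a).
Proof.
move=> r x y; rewrite /cr_op_fun scaler_sumr -big_split; apply: eq_bigr => I _.
by rewrite linearP scalerDr !scalerA mulrC.
Qed.

Definition cr_op F : nattrans F (tpow_op F).
Proof.
apply: (@NatTrans k (op C) F (tpow_op F) (fun a => linear_pack (@cr_op_linear F a))).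
move=> a b f x; rewrite /= /cr_op_fun linear_sum; apply: eq_bigr => I _.
rewrite linearZ -!(@fmap_comp k (op C) F) /=; congr (_ *: (fmap F _ _)).
exact/esym/power_fold_natural.
Defined.

Lemma cr_op_natural F G (h : nattrans F G) (a : C) (x : F a) :
  cr_op G a (h a x) = tpow_op_map h a (cr_op F a x).
Proof.
rewrite /= /cr_op_fun linear_sum; apply: eq_bigr => I _.
by rewrite linearZ (@natural k (op C) F G h).
Qed.

(* Label d + 1 points of E other than e by 'I_d.+1 and write a^{*E} as a retract
   of the coproduct of d + 1 copies of itself, the i-th copy retaining only the
   factors with label i.  After omission of the i-th copy the terms of cr_op
   indexed by I and by I with the i-th point adjoined cancel. *)
Lemma cr_op_polynomial F (d : nat) : #|E| = d.+2 ->
  polynomial_of_degree d F -> forall (a : C) (x : F a), cr_op F a x = 0.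
Proof.
move=> cE Fpoly a x.
pose s := enum [set~ e]; have szs : size s = d.+1 by rewrite -cardE cardsC1 cE.
(* The point [e] is not in [s]: its index is out of range and [inord] gives it the default label
   0. *)
pose p (y : E) : 'I_d.+1 := inord (index y s).
have sP (i : 'I_d.+1) : nth e s i != e /\ p (nth e s i) = i.
  split.
    have : nth e s i \in s by rewrite mem_nth ?szs.
    by rewrite mem_enum !inE.
  by rewrite /p index_uniq ?szs ?enum_uniq // inord_val.
pose b (i : 'I_d.+1) := power E a.
pose phi_ (i : 'I_d.+1) : hom (b i) (power E a) :=
  copair (fun y => if p y == i then coinj (fun _ : E => a) y else zerom a _).
pose phi : hom (coprod b) (power E a) := copair phi_.
pose psi : hom (power E a) (coprod b) :=
  copair (fun y => comp (coinj b (p y)) (coinj (fun _ : E => a) y)).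
have psiK : comp phi psi = idm _.
  apply: copair_uniq => y; rewrite -compA !copairE compA !copairE eqxx.
  by rewrite comp1m.
have -> : cr_op F a x =
    @fmap k (op C) F _ _ psi (@fmap k (op C) F _ _ phi (cr_op F a x)).
  rewrite -(@fmap_comp k (op C) F) /= psiK.
  exact/esym/(@fmap_id k (op C) F).
rewrite [X in fmap F psi X](_ : _ = 0) ?linear0 //.
apply: Fpoly => i; rewrite -(@fmap_comp k (op C) F) /= /cr_op_fun linear_sum /=.
have [xe px] := sP i.
under eq_bigr => I _ do rewrite linearZ -(@fmap_comp k (op C) F) /=.
apply: (alternating_sum_eq0 (x := nth e s i)) => // I xI.
congr (fmap F _ _); apply: copair_uniq => -[j ji].
rewrite -!compA (copairE (fun u : {j | j != i} => coinj b (val u)) (exist _ j ji)).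
rewrite /= (copairE phi_ j); apply: copair_uniq => y.
(* A factor [y] kept by copy [j] has label [j], which differs from [i], so [y] is not the adjoined
   point and its membership is unchanged. *)
rewrite -!compA !copairE; case: eqP => [py|_]; last by rewrite !comp_zerom.
rewrite !copairE !inE; case: eqP => [yx|//].
by rewrite -py yx px eqxx in ji.
Qed.

End ContravariantPowers.

(** * Lifting maps out of projective functors *)

Section Corestriction.
Variables (k : pzRingType) (U V : lmodType k) (S : submodClosed V).
Variables (f : {linear U -> V}) (fS : forall u, f u \in S).

Fact corestrict_linear : linear (fun u => SubmodT (fS u) : submodT S).
Proof. by move=> r u v; apply: val_inj; rewrite /= linearP. Qed.

Definition corestrict : {linear U -> submodT S} := linear_pack corestrict_linear.
End Corestriction.

Section Lifting.
Variables (k : comPzRingType) (C : category).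
Implicit Types P X Y Z : modfunctor k C.

Definition kerf_corestrict X Y Z (g : nattrans Y Z) (f : nattrans X Y)
    (gf : forall a x, f a x \in kermod (g a)) : nattrans X (kerf g).
Proof.
apply: (@NatTrans k C X (kerf g) (fun a => corestrict (gf a))).
by move=> a b h x; apply: val_inj; rewrite /= natural.
Defined.

(** By exactness [d] corestricts to an epimorphism onto the kernel of [g], where [f] lands too. *)
Lemma projective_lift P X Y Z (d : nattrans X Y) (g : nattrans Y Z)
    (f : nattrans P Y) :
  projective P ->
  (forall a y, g a y = 0 <-> exists x, d a x = y) ->
  (forall a x, g a (f a x) = 0) ->
  exists h : nattrans P X, forall a x, d a (h a x) = f a x.
Proof.
move=> Pproj ex gf.
have gd a x : d a x \in kermod (g a) by apply/eqP/ex; exists x.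
have gf' a x : f a x \in kermod (g a) by apply/eqP/gf.
have [|h hP] := Pproj _ _ (kerf_corestrict gd) (kerf_corestrict gf').
  apply/epimorphismP => a [y gy]; have [x xy] := iffLR (ex a y) (eqP gy).
  by exists x; apply: val_inj.
by exists h => a x; have /(congr1 val) := hP a x.
Qed.

End Lifting.

(** * Null-homotopy of the contravariant cross effect on a resolution *)

Section NullHomotopy.
Variables (k : comPzRingType) (C : zcategory) (E : finType) (e : E).
Variables (F : modfunctor k (op C)) (P : projres F).
Hypothesis crF : forall a (x : F a), cr_op e F a x = 0.

Lemma res_dd n a (x : res P n.+2 a) : res_d P n a (res_d P n.+1 a x) = 0.
Proof. by apply/res_exactS; exists x. Qed.

(** Exactness is objectwise, so this is exactness of the resolution at [power E a]. *)
Lemma tpow_op_res_exactS n a (x : tpow_op E (res P n.+1) a) :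
  tpow_op_map E (res_d P n) a x = 0 <->
  exists y, tpow_op_map E (res_d P n.+1) a y = x.
Proof. exact: res_exactS. Qed.

Lemma cr_op_homotopy0 : exists h : nattrans (res P 0) (tpow_op E (res P 1)),
  forall a x, tpow_op_map E (res_d P 0) a (h a x) = cr_op e (res P 0) a x.
Proof.
apply: (@projective_lift _ _ _ _ _ _ _ (tpow_op_map E (res_aug P))).
- exact: res_projective.
- by move=> a x; apply: (@res_exact0 k (op C) F P (power E a) x).
by move=> a x; rewrite -cr_op_natural crF.
Qed.

Definition nattrans_sub (G H : modfunctor k (op C)) (f g : nattrans G H) :
  nattrans G H.
Proof.
apply: (@NatTrans k (op C) G H (fun a => f a \- g a)).
by move=> a b h x; rewrite /= linearB !natural.
Defined.

(** The relation is assumed on boundaries only: there the term of lower degree vanishes because d d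
    = 0, so the hypothesis has the same form in degree 0 and in higher degrees. *)
Lemma cr_op_homotopy_step n (h : nattrans (res P n) (tpow_op E (res P n.+1))) :
  (forall a x, tpow_op_map E (res_d P n) a (h a (res_d P n a x)) =
     cr_op e (res P n) a (res_d P n a x)) ->
  exists h' : nattrans (res P n.+1) (tpow_op E (res P n.+2)), forall a x,
    tpow_op_map E (res_d P n.+1) a (h' a x) =
    cr_op e (res P n.+1) a x - h a (res_d P n a x).
Proof.
move=> hP.
apply: (@projective_lift _ _ _ _ _ _ _ (tpow_op_map E (res_d P n))
  (nattrans_sub (cr_op e (res P n.+1)) (nattrans_comp h (res_d P n)))).
- exact: res_projective.
- exact: tpow_op_res_exactS.
by move=> a x; rewrite [X in _ X]/= linearB -cr_op_natural hP subrr.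
Qed.

Lemma cr_op_homotopy n :
  exists h : nattrans (res P n) (tpow_op E (res P n.+1)),
  forall a x, tpow_op_map E (res_d P n) a (h a (res_d P n a x)) =
    cr_op e (res P n) a (res_d P n a x).
Proof.
elim: n => [|n [h hP]].
  by have [h hP] := cr_op_homotopy0; exists h.
have [h' h'P] := cr_op_homotopy_step hP; exists h' => a x.
by rewrite h'P res_dd linear0 subr0.
Qed.

(** Two consecutive components of the homotopy, which is what one degree of homology uses. *)
Lemma cr_op_homotopyS n :
  exists (h : nattrans (res P n) (tpow_op E (res P n.+1)))
    (h' : nattrans (res P n.+1) (tpow_op E (res P n.+2))), forall a x,
    cr_op e (res P n.+1) a x =
    tpow_op_map E (res_d P n.+1) a (h' a x) + h a (res_d P n a x).
Proof.
have [h hP] := cr_op_homotopy n; have [h' h'P] := cr_op_homotopy_step hP.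
by exists h, h' => a x; rewrite h'P subrK.
Qed.

End NullHomotopy.

(** * Tensor products over a category *)

(** The elements satisfying [Q] form a submodule; the quotient map by it and the zero map agree on
    the basis, hence everywhere. *)
Lemma free_ind (k : pzRingType) (X : Type) (Q : freemod k X -> Prop) :
  Q 0 -> (forall r u v, Q u -> Q v -> Q (r *: u + v)) ->
  (forall x, Q (fdelta k x)) -> forall u, Q u.
Proof.
move=> Q0 QP Qx u.
have Qclosed : GRing.subsemimod_closed (fun u => `[< Q u >]).
  split=> [|r v /asboolP Qv]; last by apply/asboolP; rewrite -[_ *: _]addr0; apply: QP.
  split=> [|v w /asboolP Qv /asboolP Qw]; apply/asboolP => //.
  by rewrite -[v]scale1r; apply: QP.
pose I : submodClosed _ := HB.pack (fun u => `[< Q u >] : bool)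
  (GRing.isSubmodClosed.Build k (freemod k X) _ Qclosed).
have : lpi I u = (\0 : {linear freemod k X -> lquot I}) u.
  by apply: free_ext => x; apply/eqP; rewrite lpi_eq0; apply/asboolP/Qx.
by move/eqP; rewrite lpi_eq0 => /asboolP.
Qed.

Section CoendRight.
Variables (k : comPzRingType) (C : category).
Implicit Types (F G : modfunctor k (op C)) (S T : modfunctor k C).

Lemma tens0l F T (a : C) (x : T a) : tens (0 : F a) x = 0.
Proof. by rewrite -(scale0r (0 : F a)) tensZl scale0r. Qed.

Lemma tens0r F T (a : C) (y : F a) : tens y (0 : T a) = 0.
Proof. by rewrite -(scale0r (0 : T a)) tensZr scale0r. Qed.

Definition coend_mapr F S T (eta : nattrans S T) :
  {linear coend F S -> coend F T}.
Proof.
apply: (@coend_lift k C F S (coend F T) (fun a y x => tens y (eta a x))).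
- by move=> a y y' x; rewrite tensDl.
- by move=> a y x x'; rewrite linearD tensDr.
- by move=> a r y x; rewrite tensZl.
- by move=> a r y x; rewrite linearZ tensZr.
- by move=> a b f y x; rewrite tensNat natural.
Defined.

Lemma coend_maprE F S T (eta : nattrans S T) (a : C) (y : F a) (x : S a) :
  coend_mapr F eta (tens y x) = tens y (eta a x).
Proof. exact: coend_liftE. Qed.

Lemma coend_ind F T (Q : coend F T -> Prop) :
  Q 0 -> (forall r u v, Q u -> Q v -> Q (r *: u + v)) ->
  (forall (a : C) (y : F a) (x : T a), Q (tens y x)) -> forall c, Q c.
Proof.
move=> Q0 QP Qt c; rewrite -(lreprK c).
elim/free_ind: (lrepr c) => [|r u v Qu Qv|[a [y x]]]; first by rewrite linear0.
  by rewrite linearP; apply: QP.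
exact: Qt.
Qed.

Lemma coend_map_mapr F G (h : nattrans F G) S T (eta : nattrans S T)
    (c : coend F S) :
  coend_map h T (coend_mapr F eta c) = coend_mapr G eta (coend_map h S c).
Proof.
elim/coend_ind: c => [|r u v IHu IHv|a y x]; first by rewrite !linear0.
  by rewrite !linearP IHu IHv.
by rewrite !(coend_maprE, coend_mapE).
Qed.

Lemma coend_mapr_surj F S T (eta : nattrans S T) :
  (forall a x, exists y, eta a y = x) ->
  forall c, exists c', coend_mapr F eta c' = c.
Proof.
move=> surj; elim/coend_ind => [|r u v [u' <-] [v' <-]|a y x].
- by exists 0; rewrite linear0.
- by exists (r *: u' + v'); rewrite linearP.
by have [z <-] := surj a x; exists (tens y z); rewrite coend_maprE.
Qed.

Lemma freef_ind F (b : C) (Q : freef F b -> Prop) :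
  Q 0 -> (forall r u v, Q u -> Q v -> Q (r *: u + v)) ->
  (forall (a : C) (x : F a) (f : hom b a),
    Q (@freef_elt k (op C) F a b x f)) -> forall u, Q u.
Proof. by move=> Q0 QP Qf; apply: free_ind => // -[a [x f]]; apply: Qf. Qed.

(** * Coends of short exact sequences that split objectwise, not naturally *)

Section Split.
Variables (K L T : modfunctor k C) (i : nattrans K L) (p : nattrans L T).
Variables (s : forall a : C, {linear T a -> L a})
  (r : forall a : C, {linear L a -> K a}).
Hypothesis ps : forall a x, p a (s a x) = x.
Hypothesis ri : forall a x, r a (i a x) = x.
Hypothesis p_i : forall a x, p a (i a x) = 0.
Hypothesis ir_sp : forall a x, i a (r a x) = x - s a (p a x).

Lemma coend_mapr_comp0 F (c : coend F K) :
  coend_mapr F p (coend_mapr F i c) = 0.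
Proof.
elim/coend_ind: c => [|r' u v IHu IHv|a y x]; first by rewrite !linear0.
  by rewrite !linearP IHu IHv scaler0 addr0.
by rewrite !coend_maprE p_i tens0r.
Qed.

(** Modulo the image of [i], sending y (x) x to y (x) s x is well defined on the coend with [T].
    Composed with [p] it is the quotient map, so whatever [p] kills lies in that image. *)
Lemma coend_mapr_exact F (c : coend F L) :
  coend_mapr F p c = 0 -> exists c', coend_mapr F i c' = c.
Proof.
pose I : submodClosed _ := preimmod idfun (coend_mapr F i).
(* The failure of [s] to commute with [f] is killed by [p], and [ir_sp] exhibits it as a value of
   [i]. *)
have nat (a b : C) (f : hom a b) (y : F b) (x : T a) :
    lpi I (tens (@fmap k (op C) F b a f y) (s a x)) =
    lpi I (tens y (s b (fmap T f x))).
  apply/eqP; rewrite -subr_eq0 -linearB lpi_eq0; apply/asboolP.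
  rewrite tensNat; exists (tens y (r b (fmap L f (s a x)))).
  rewrite coend_maprE ir_sp natural ps /=.
  by rewrite tensDr -scaleN1r tensZr scaleN1r.
have [h hE] : exists h : {linear coend F T -> lquot I},
    forall a (y : F a) x, h (tens y x) = lpi I (tens y (s a x)).
  unshelve eexists.
    apply: (@coend_lift k C F T (lquot I)
      (fun a y x => lpi I (tens y (s a x)))).
    - by move=> a y y' x; rewrite tensDl linearD.
    - by move=> a y x x'; rewrite linearD tensDr linearD.
    - by move=> a q y x; rewrite tensZl linearZ.
    - by move=> a q y x; rewrite linearZ tensZr linearZ.
    - exact: nat.
  by move=> a y x; rewrite coend_liftE.
have hp : lpi I c = h (coend_mapr F p c).
  elim/coend_ind: c => [|r' u v IHu IHv|a y x]; first by rewrite !linear0.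
    by rewrite !linearP IHu IHv.
  rewrite coend_maprE hE; apply/eqP; rewrite -subr_eq0 -linearB lpi_eq0.
  apply/asboolP; exists (tens y (r a x)).
  by rewrite coend_maprE ir_sp tensDr -scaleN1r tensZr scaleN1r.
move=> pc; move: hp; rewrite pc linear0 => /eqP.
by rewrite lpi_eq0 => /asboolP.
Qed.

(* A natural map with a pointwise linear retraction r stays split injective
   after tensoring with a free functor: send a generator (x, f) (x) l to
   (x, id) (x) r (f l). *)
Lemma coend_mapr_free_inj F (c : coend (freef F) K) :
  coend_mapr (freef F) i c = 0 -> c = 0.
Proof.
pose beta (b : C) (l : L b) : {linear freef F b -> coend (freef F) K} :=
  free_lift (fun u : @freef_gen k (op C) F b =>
    @tens k C (freef F) K (projT1 u)
      (@freef_elt k (op C) F _ _ (projT2 u).1 (@idm (op C) _))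
      (r (projT1 u) (@fmap k C L b (projT1 u) (projT2 u).2 l))).
have betaE (a b : C) (x : F a) (f : hom b a) (l : L b) :
    beta b l (@freef_elt k (op C) F a b x f) =
    @tens k C (freef F) K a (@freef_elt k (op C) F a a x (@idm (op C) a))
      (r a (fmap L f l)).
  exact: free_liftE.
have [h hE] : exists h : {linear coend (freef F) L -> coend (freef F) K},
    forall b (y : freef F b) l, h (tens y l) = beta b l y.
  unshelve eexists.
    apply: (@coend_lift k C (freef F) L _ (fun b y l => beta b l y)).
    - by move=> b y y' l; rewrite linearD.
    - move=> b y l l'.
      elim/freef_ind: y => [|q u v IHu IHv|a x f].
      + by rewrite !linear0 addr0.
      + by rewrite !linearP IHu IHv scalerDr addrACA.
      + by rewrite !betaE !linearD tensDr.
    - by move=> b q y l; rewrite linearZ.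
    - move=> b q y l.
      elim/freef_ind: y => [|q' u v IHu IHv|a x f].
      + by rewrite !linear0.
      + by rewrite !linearP IHu IHv.
      + by rewrite !betaE !linearZ tensZr.
    - move=> b b' g y l.
      elim/freef_ind: y => [|q u v IHu IHv|a x f].
      + by rewrite !linear0.
      + by rewrite !linearP IHu IHv.
      (* [r] acts at the object carrying the generator, after [l] has been transported there, so
         compatibility with [g] is just functoriality of [L]. *)
      + by rewrite [fmap _ _ _](@freef_fmapE k (op C) F) !betaE fmap_comp.
  by move=> b y l; rewrite coend_liftE.
have hi : h (coend_mapr (freef F) i c) = c.
  elim/coend_ind: c => [|r' u v IHu IHv|b y x]; first by rewrite !linear0.
    by rewrite !linearP IHu IHv.
  rewrite coend_maprE hE.
  elim/freef_ind: y => [|q u v IHu IHv|a z f].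
  - by rewrite linear0 tens0l.
  - by rewrite linearP IHu IHv tensDl tensZl.
  - rewrite betaE -natural ri -tensNat; congr (tens _ _).
    by rewrite [LHS](@freef_fmapE k (op C) F) /= comp1m.
by move=> ic; rewrite -hi ic linear0.
Qed.

(** [P] is a retract of its free cover, and injectivity passes to retracts. *)
Lemma coend_mapr_projective_inj P (c : coend P K) :
  projective P -> coend_mapr P i c = 0 -> c = 0.
Proof.
move=> Pproj ic.
pose idn := @NatTrans k (op C) P P (fun a => idfun) (fun a b f x => erefl).
have [|g gP] := Pproj _ _ (freef_cover P) idn.
  by apply/epimorphismP => a x; apply: freef_cover_surj.
have gK T' (c' : coend P T') :
    coend_map (freef_cover P) T' (coend_map g T' c') = c'.
  elim/coend_ind: c' => [|r' u v IHu IHv|a y x]; first by rewrite !linear0.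
    by rewrite !linearP IHu IHv.
  by rewrite !coend_mapE gP.
rewrite -(gK K c) (@coend_mapr_free_inj P (coend_map g K c)) ?linear0 //.
by rewrite -coend_map_mapr ic linear0.
Qed.
End Split.
End CoendRight.

(** * The kernel of the cross effect and vanishing of Tor *)

Section PowerSwap.
Variables (C : zcategory) (E : finType).

Definition power_swap (a : C) :
    hom (power E (power E a)) (power E (power E a)) :=
  copair (fun x => copair (fun y =>
    comp (coinj (fun _ : E => power E a) y) (coinj (fun _ : E => a) x))).

Lemma power_swapE (a : C) (x y : E) :
  comp (comp (power_swap a) (coinj (fun _ : E => power E a) x))
    (coinj (fun _ : E => a) y) =
  comp (coinj (fun _ : E => power E a) y) (coinj (fun _ : E => a) x).
Proof. by rewrite !copairE. Qed.

Lemma power_uniq2 (a b : C) (g h : hom (power E (power E a)) b) :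
  (forall x y, comp (comp g (coinj (fun _ : E => power E a) x))
      (coinj (fun _ : E => a) y) =
    comp (comp h (coinj (fun _ : E => power E a) x)) (coinj (fun _ : E => a) y)) ->
  g = h.
Proof. by move=> gh; do 2![apply: copair_uniq => ?]; apply: gh. Qed.

Lemma power_mapE (a b : C) (f : hom a b) (x : E) :
  comp (power_map E f) (coinj (fun _ : E => a) x) =
  comp (coinj (fun _ : E => b) x) f.
Proof. exact: copairE. Qed.

Lemma power_foldE (I : {set E}) (a : C) (x : E) :
  comp (power_fold I a) (coinj (fun _ : E => a) x) =
  if x \in I then idm a else zerom a a.
Proof. exact: copairE. Qed.

(** The swap exchanges folding along the outer power with folding along the inner one. *)
Lemma power_fold_swap (I : {set E}) (a : C) :
  comp (power_fold I (power E a)) (power_swap a) = power_map E (power_fold I a).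
Proof.
apply: power_uniq2 => x y.
rewrite -[in LHS]compA -[in LHS]compA [comp (power_swap a) _]compA power_swapE.
rewrite compA power_foldE power_mapE -compA power_foldE.
by case: ifP; rewrite ?comp1m ?compm1 // zerom_comp comp_zerom.
Qed.

Lemma power_map_fold_swap (I : {set E}) (a : C) :
  comp (power_map E (power_fold I a)) (power_swap a) = power_fold I (power E a).
Proof.
apply: power_uniq2 => x y.
rewrite -[in LHS]compA -[in LHS]compA [comp (power_swap a) _]compA power_swapE.
rewrite compA power_mapE -[in LHS]compA !power_foldE.
by case: ifP; rewrite ?comp1m ?compm1 // zerom_comp comp_zerom.
Qed.

Lemma power_swap_natural (a b : C) (f : hom a b) :
  comp (power_swap b) (power_map E (power_map E f)) =
  comp (power_map E (power_map E f)) (power_swap a).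
Proof.
apply: power_uniq2 => x y.
rewrite -[in RHS]compA -[in RHS]compA [comp (power_swap a) _]compA power_swapE.
rewrite [in RHS]compA power_mapE -[in RHS]compA power_mapE.
rewrite -[in LHS]compA -[in LHS]compA.
rewrite [comp (power_map E (power_map E f)) (comp (coinj (fun=> power E a) x) _)]compA.
rewrite power_mapE -[in LHS]compA power_mapE.
by rewrite [in LHS]compA [in LHS]compA power_swapE [in RHS]compA.
Qed.
End PowerSwap.

Section Tor.
Variables (C : zcategory) (k : comPzRingType) (E : finType) (e : E).
Implicit Types (F P : modfunctor k (op C)) (T : modfunctor k C).

Section KernelSplitting.
Hypothesis codiag_Ec : forall a : C, Ec (codiag a).
Variable T : modfunctor k C.
Variable s : forall a : C, {linear T a -> tpow E T a}.
Hypothesis s_split : weakly_natural_splitting (cr T e) s.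

Let s_nat : weakly_natural s := s_split.1.
Let sK a x : cr T e a (s a x) = x := s_split.2 a x.

Let K := kerf (cr T e).

(** The swap moves the power created by [s] inside. Left outside, [cr] would return the original
    element instead of 0. *)
Let split_swap (a : C) : {linear K a -> T (power E (power E a))} :=
  fmap T (power_swap E a) \o s (power E a) \o submod_incl (kermod (cr T e a)).

Lemma split_power_fold (I : {set E}) (a : C) (x : tpow E T a) : e \in I ->
  fmap (tpow E T) (power_fold I a) (s (power E a) x) =
  s a (fmap T (power_fold I a) x).
Proof. by move=> eI; rewrite -s_nat //; apply: Ec_power_fold eI. Qed.

Fact split_swap_ker (a : C) (x : K a) : split_swap a x \in kermod (cr T e (power E a)).
Proof.
apply/eqP; have /eqP cx : val x \in kermod (cr T e a) := valP x.
(* After the swap every fold acts on the inner power and commutes with [s], so the alternating sum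
   can be taken before [s]. *)
transitivity (s a (cr T e a (val x))); last by rewrite cx linear0.
rewrite [LHS]/= [cr T e a _]/= /cr_fun linear_sum; apply: eq_bigr => I eI.
rewrite linearZ; congr (_ *: _); rewrite -[RHS]split_power_fold //=.
by rewrite -fmap_comp power_fold_swap.
Qed.

Definition ker_split (a : C) : {linear K a -> tpow E K a} :=
  corestrict (@split_swap_ker a).

Lemma ker_splitP : weakly_natural_splitting (cr K e) ker_split.
Proof.
split=> [a b v vEc x|a x]; apply: val_inj.
  rewrite /= s_nat; last exact: Ec_power_map.
  by rewrite -!fmap_comp power_swap_natural.
(* The folds of [cr K] act on the inner power; the swap turns them into those of [cr T] at
   [power E a], which [s] splits. *)
rewrite -[RHS](sK (val x)) [RHS]/= /cr_fun.
rewrite [LHS](linear_sum (submod_incl (kermod (cr T e a)))).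
apply: eq_bigr => I eI /=.
by rewrite -fmap_comp power_map_fold_swap.
Qed.

Let retr_ker (a : C) (x : tpow E T a) :
  (idfun \- (s a \o cr T e a)) x \in kermod (cr T e a).
Proof. by apply/eqP; rewrite [X in _ X]/= linearB sK subrr. Qed.

(** The projection onto the kernel along the image of [s]; it completes the objectwise splitting
    data. *)
Definition ker_retr (a : C) : {linear tpow E T a -> K a} :=
  corestrict (@retr_ker a).

Lemma ker_retrE (a : C) (x : tpow E T a) :
  kerf_incl (cr T e) a (ker_retr a x) = x - s a (cr T e a x).
Proof. by []. Qed.

Lemma ker_retrK (a : C) (x : K a) : ker_retr a (kerf_incl (cr T e) a x) = x.
Proof.
apply: val_inj; have /eqP cx : val x \in kermod (cr T e a) := valP x.
by rewrite [LHS]ker_retrE [cr T e a _]cx linear0 subr0.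
Qed.

Lemma cr_kerf_incl (a : C) (x : K a) : cr T e a (kerf_incl (cr T e) a x) = 0.
Proof. exact/eqP/(valP x). Qed.

Lemma coend_cr_surj F (c : coend F T) :
  exists c', coend_mapr F (cr T e) c' = c.
Proof. by apply: coend_mapr_surj => a x; exists (s a x). Qed.

Lemma coend_cr_exact F (c : coend F (tpow E T)) :
  coend_mapr F (cr T e) c = 0 -> exists c', coend_mapr F (kerf_incl (cr T e)) c' = c.
Proof. exact: (coend_mapr_exact sK ker_retrE). Qed.

Lemma coend_cr_incl F (c : coend F K) :
  coend_mapr F (cr T e) (coend_mapr F (kerf_incl (cr T e)) c) = 0.
Proof. exact: (coend_mapr_comp0 cr_kerf_incl). Qed.

Lemma coend_kerf_incl_inj P (c : coend P K) :
  projective P -> coend_mapr P (kerf_incl (cr T e)) c = 0 -> c = 0.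
Proof. exact: (coend_mapr_projective_inj ker_retrK). Qed.
End KernelSplitting.

(** * Moving the cross effect across the tensor product *)

Definition coend_pow F T : {linear coend (tpow_op E F) (tpow E T) -> coend F T}.
Proof.
apply: (@coend_lift k C (tpow_op E F) (tpow E T) (coend F T)
  (fun a y x => @tens k C F T (power E a) y x)).
- by move=> a y y' x; rewrite -tensDl.
- by move=> a y x x'; rewrite -tensDr.
- by move=> a r y x; rewrite -tensZl.
- by move=> a r y x; rewrite -tensZr.
- by move=> a b f y x; rewrite /= tensNat.
Defined.

Lemma coend_powE F T (a : C) (y : tpow_op E F a) (x : tpow E T a) :
  coend_pow F T (tens y x) = @tens k C F T (power E a) y x.
Proof. exact: coend_liftE. Qed.

Lemma coend_pow_map F G (h : nattrans F G) T c :
  coend_map h T (coend_pow F T c) =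
  coend_pow G T (coend_map (tpow_op_map E h) (tpow E T) c).
Proof.
elim/coend_ind: c => [|r u v IHu IHv|a y x]; first by rewrite !linear0.
  by rewrite !linearP IHu IHv.
by rewrite coend_powE !coend_mapE coend_powE.
Qed.

Lemma tens_suml F T (I : Type) (r : seq I) (Q : pred I) (a : C) (y : I -> F a)
    (x : T a) :
  tens (\sum_(i <- r | Q i) y i) x = \sum_(i <- r | Q i) tens (y i) x.
Proof.
by elim/big_rec2: _ => [|i u v _ <-]; rewrite ?tens0l ?tensDl.
Qed.

Lemma tens_sumr F T (I : Type) (r : seq I) (Q : pred I) (a : C) (y : F a)
    (x : I -> T a) :
  tens y (\sum_(i <- r | Q i) x i) = \sum_(i <- r | Q i) tens y (x i).
Proof.
by elim/big_rec2: _ => [|i u v _ <-]; rewrite ?tens0r ?tensDr.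
Qed.

(** Each fold crosses the tensor sign by the coend relation, and both cross effects carry the same
    signs. *)
Lemma coend_cr_pow F T c :
  coend_mapr F (cr T e) c = coend_pow F T (coend_map (cr_op e F) (tpow E T) c).
Proof.
elim/coend_ind: c => [|r u v IHu IHv|a y x]; first by rewrite !linear0.
  by rewrite !linearP IHu IHv.
rewrite coend_maprE coend_mapE coend_powE tens_sumr tens_suml.
apply: eq_bigr => I _; rewrite tensZl tensZr; congr (_ *: _).
by rewrite -tensNat.
Qed.

Lemma coend_map_sum_comp F G H (f g1 : nattrans F H) (f1 : nattrans F G)
    (f2 : nattrans G H) T (c : coend F T) :
  (forall a x, f a x = f2 a (f1 a x) + g1 a x) ->
  coend_map f T c = coend_map f2 T (coend_map f1 T c) + coend_map g1 T c.
Proof.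
move=> fE; elim/coend_ind: c => [|r u v IHu IHv|a y x].
- by rewrite !linear0 addr0.
- by rewrite !linearP IHu IHv scalerDr addrACA.
by rewrite !coend_mapE fE tensDl.
Qed.

Lemma coend_map_comp F G H (f : nattrans F H) (f1 : nattrans F G)
    (f2 : nattrans G H) T (c : coend F T) :
  (forall a x, f a x = f2 a (f1 a x)) ->
  coend_map f T c = coend_map f2 T (coend_map f1 T c).
Proof.
move=> fE; elim/coend_ind: c => [|r u v IHu IHv|a y x].
- by rewrite !linear0.
- by rewrite !linearP IHu IHv.
by rewrite !coend_mapE fE.
Qed.

(** * Acyclicity of the tensored resolution *)

Variables (F : modfunctor k (op C)) (P : projres F).
Hypothesis crF : forall a (x : F a), cr_op e F a x = 0.
Hypothesis codiag_Ec : forall a : C, Ec (codiag a).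

Let d T n := coend_map (res_d P n) T.

Lemma coend_cr_boundary0 T (c : coend (res P 0) (tpow E T)) :
  exists y, d T 0 y = coend_mapr (res P 0) (cr T e) c.
Proof.
have [h hP] := cr_op_homotopy0 P crF.
exists (coend_pow _ T (coend_map h (tpow E T) c)).
rewrite coend_cr_pow [LHS]coend_pow_map.
by rewrite -(coend_map_comp (f := cr_op e (res P 0))) // => a x; rewrite -hP.
Qed.

Lemma coend_cr_boundaryS T n (c : coend (res P n.+1) (tpow E T)) :
  d (tpow E T) n c = 0 ->
  exists y, d T n.+1 y = coend_mapr (res P n.+1) (cr T e) c.
Proof.
move=> dc; have [h [h' hP]] := cr_op_homotopyS P crF n.
exists (coend_pow _ T (coend_map h' (tpow E T) c)).
rewrite coend_cr_pow [LHS]coend_pow_map.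
(* The homotopy splits the cross effect into a boundary and a term factoring through the
   differential of [c], which is zero. *)
rewrite (@coend_map_sum_comp _ _ _ _ (nattrans_comp h (res_d P n)) h' _ _ c hP).
rewrite (@coend_map_comp _ _ _ (nattrans_comp h (res_d P n)) (res_d P n) h _ c) //.
by rewrite [coend_map (res_d P n) _ c]dc linear0 addr0.
Qed.

Lemma coend_d_mapr S T (eta : nattrans S T) n c :
  d T n (coend_mapr _ eta c) = coend_mapr _ eta (d S n c).
Proof. exact: coend_map_mapr. Qed.

Lemma coend_dd T n (c : coend (res P n.+2) T) : d T n (d T n.+1 c) = 0.
Proof.
elim/coend_ind: c => [|r u v IHu IHv|a y x]; first by rewrite !linear0.
  by rewrite !linearP IHu IHv scaler0 addr0.
by rewrite /d !coend_mapE res_dd tens0l.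
Qed.

Lemma coend_res_acyclic n T :
  (exists s, weakly_natural_splitting (cr T e) s) ->
  forall c : coend (res P n) T,
    is_cycle (fun i => coend_map (res_d P i) T) c -> exists y, d T n y = c.
Proof.
elim: n T => [|n IHn] T [s sP] c.
  by move=> _; have [c' <-] := coend_cr_surj sP c; apply: coend_cr_boundary0.
move=> dc; have [c' c'E] := coend_cr_surj sP c.
(* The cross effect sends the boundary of [c'] to that of [c], which is 0, so the boundary of [c']
   comes from the kernel. *)
have [|z zE] := coend_cr_exact sP (c := d (tpow E T) n c').
  by rewrite -coend_d_mapr c'E.
(* In positive degree the boundary of [z] maps to d d c' = 0, and the inclusion of the kernel stays
   injective after tensoring with a projective. *)
have zcycle : is_cycle (fun i => coend_map (res_d P i) (kerf (cr T e))) z.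
  case: n c c' z dc c'E zE {IHn} => [//|n] c c' z dc c'E zE.
  apply: (coend_kerf_incl_inj sP (@res_projective _ _ _ P n)).
  by rewrite -[LHS]coend_d_mapr zE coend_dd.
have [|y yE] := IHn (kerf (cr T e)) _ z zcycle.
  by exists (ker_split codiag_Ec sP); apply: ker_splitP.
(* Subtracting the image of [y] makes [c'] a cycle and does not change its cross effect [c]. *)
have [|w wE] := coend_cr_boundaryS (c := c' - coend_mapr _ (kerf_incl (cr T e)) y).
  by rewrite linearB coend_d_mapr yE zE subrr.
by exists w; rewrite wE linearB coend_cr_incl subr0.
Qed.

End Tor.

Theorem proposition5p7 (C : zcategory)
    (codiag_Ec : forall a : C, Ec (codiag a))
    (k : comPzRingType) (T : modfunctor k C) (d : nat)
    (E : finType) (e : E) (cardE : #|E| = d.+2)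
    (cr_epi : epimorphism (cr T e))
    (cr_split : exists s, weakly_natural_splitting (cr T e) s)
    (F : modfunctor k (op C)) (F_poly : polynomial_of_degree d F)
    (P : projres F) (n : nat) (x : Tor T P n) :
  x = 0.
Proof.
move: x; apply/homology_eq0P.
apply: coend_res_acyclic cr_split => // a x.
exact: cr_op_polynomial cardE F_poly a x.
Qed.
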